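(* For all integers $n > 0$ and $m \geq 0$, the suffix $\mathcal{K}_m$ of the order-$n$ lexicographically least binary de Bruijn sequence $\mathcal{F}_n$ satisfies \[ \operatorname{sk}(\mathcal{K}_m) = -G^{m+1}_{n-1} \quad\text{and}\quad |\mathcal{K}_m| = H^{m+1}_{n}. \]
   Context: Words are over the alphabet $\{0,1\}$; $|w|$ is the length of a word $w$; $\varepsilon$ is the empty word. The skew $\operatorname{sk}(w)$ is the number of $0$'s in $w$ minus the number of $1$'s in $w$. A binary Lyndon word is a nonempty binary word that is aperiodic (not a proper power $u^r$, $r\ge 2$) and is lexicographically least among its rotations. For $n\ge 1$, $\mathcal{F}_n$ denotes the lexicographically least binary de Bruijn sequence of order $n$ (a word of length $2^n$ which, read cyclically, contains each of the $2^n$ binary words of length $n$ as a subword); by a theorem of Fredricksen it equals the concatenation, in lexicographic order, of all binary Lyndon words of length dividing $n$. Fix $n\ge 1$. Let $\ell_0 = 1$ (the one-letter word). For $1 \le i \le n-1$, let $\ell_i$ be the concatenation, in lexicographic order, of all binary Lyndon words of length $d > 1$ with $d \mid n$ which contain $0^i$ but not $0^{i+1}$ as a subword (contiguous factor). For $i > n-1$ with $i\geq 1$, let $\ell_i = \varepsilon$. For $m\ge 0$ let \[ \mathcal{K}_m = \ell_m \ell_{m-1}\cdots \ell_1 \ell_0, \] which is a proper suffix of $\mathcal{F}_n$ (it depends on $n$). For $m\ge 1$, $G^m_n$ is the integer sequence with $G^m_n = \sum_{i=1}^m G^m_{n-i}$ for $n \ge m$ and $G^m_0 = G^m_1 = \cdots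 = G^m_{m-1} = 1$. For $m \ge 1$, $H^m_n$ is the integer sequence with $H^m_n = \sum_{i=1}^m H^m_{n-i}$ for $n\ge m$, $H^m_0 = m$, and $H^m_i = 2^i - 1$ for $1 \le i \le m-1$. (Superscripts are indices, not powers.) *)

(* Defs.v *)
From HB Require Import structures.
From mathcomp Require Import all_boot all_order all_algebra.

Set Implicit Arguments.
Unset Strict Implicit.
Unset Printing Implicit Defensive.

Import Order.TTheory GRing.Theory Num.Theory.

(* The letter 0 is [false] and the letter 1 is [true]. *)
Notation word := (seq bool).

(* [seqlexi] carries the dictionary order, in which a proper prefix precedes
   its extensions; it compares words of different lengths too. *)
Definition lexle (u v : word) : bool := ((u : seqlexi bool) <= v)%O.

Definition pow (u : word) (r : nat) : word := flatten (nseq r u).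

Definition aperiodic (w : word) : Prop :=
  ~ exists u r, 2 <= r /\ w = pow u r.

Definition lyndon (w : word) : Prop :=
  [/\ w <> [::], aperiodic w & forall k, lexle w (rot k w)].

(* Decision procedure for [lyndon], used to enumerate; see [lyndonP]. *)
Definition lyndonb (w : word) : bool :=
  [&& w != [::],
      all (fun r => w != pow (take (size w %/ r) w) r) (iota 2 (size w)) &
      all (fun k => lexle w (rot k w)) (iota 0 (size w))].

Lemma size_pow u r : size (pow u r) = r * size u.
Proof. by rewrite /pow size_flatten /shape map_nseq sumn_nseq mulnC. Qed.

Lemma lyndonP w : reflect (lyndon w) (lyndonb w).
Proof.
apply: (iffP and3P) => [[/eqP wN0 /allP ap /allP ro]|[wN0 ap ro]].
  split=> [//|[u [r [r2 wE]]]|k].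
    have sw : size w = r * size u by rewrite wE size_pow.
    have u0 : 0 < size u.
      rewrite lt0n; apply/eqP => u0; apply: wN0; apply: size0nil.
      by rewrite sw u0 muln0.
    have r_in : r \in iota 2 (size w).
      by rewrite mem_iota r2 sw add2n ltnS ltnW // ltnS leq_pmulr.
    have /eqP := ap r r_in; apply; rewrite sw mulKn ?(leq_trans _ r2) //.
    suff -> : take (size u) w = u by [].
    by rewrite wE -(subnKC r2) /pow /= take_size_cat.
  have [lkw|] := ltnP k (size w); first by apply: ro; rewrite mem_iota.
  by move/rot_oversize ->; apply: lexx.
split; first exact/eqP.
  apply/allP => r; rewrite mem_iota => /andP[r2 _]; apply/eqP => wE.
  by apply: ap; exists (take (size w %/ r) w), r.
by apply/allP => k _; apply: ro.
Qed.

Definition words (d : nat) : seq word := [seq val t | t <- enum {: d.-tuple bool}].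

Definition zeros (i : nat) : word := nseq i false.

(* [infix u w] says that [u] is a contiguous factor of [w]. *)
Definition ell_words (n i : nat) : seq word :=
  sort lexle
    [seq w <- flatten [seq words d | d <- divisors n & 1 < d]
       | [&& lyndonb w, infix (zeros i) w & ~~ infix (zeros i.+1) w]].

Definition ell (n i : nat) : word :=
  if i == 0 then [:: true]
  else if i <= n.-1 then flatten (ell_words n i)
  else [::].

Lemma mem_words d w : (w \in words d) = (size w == d).
Proof.
apply/mapP/eqP => [[t _ ->]|/eqP sw]; first exact: size_tuple.
by exists (Tuple sw) => //; rewrite mem_enum.
Qed.

Lemma mem_ell_words n i w : 0 < n ->
  (w \in ell_words n i) =
  [&& 1 < size w, size w %| n, lyndonb w,
      infix (zeros i) w & ~~ infix (zeros i.+1) w].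
Proof.
move=> n0; rewrite mem_sort mem_filter andbC [RHS]andbA; congr (_ && _).
apply/flatten_mapP/andP => [[d]|[d1 dn]].
  by rewrite mem_filter -dvdn_divisors // => /andP[? ?]; rewrite mem_words => /eqP->.
by exists (size w); rewrite ?mem_words // mem_filter d1 -dvdn_divisors.
Qed.

Lemma ell_words_sorted n i : sorted lexle (ell_words n i).
Proof. by apply: sort_sorted => u v; apply: le_total. Qed.

Lemma ell_words_uniq n i : uniq (ell_words n i).
Proof.
rewrite sort_uniq; apply: filter_uniq.
elim: [seq d <- _ | _] (filter_uniq (fun d => 1 < d) (divisors_uniq n)) => //=.
move=> d s IH /andP[ds us]; rewrite cat_uniq IH // andbT.
rewrite map_inj_uniq ?enum_uniq; last exact: val_inj.
apply/hasPn => w /flatten_mapP[e es]; rewrite /= !mem_words => /eqP we.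
by apply: contraNneq ds => <-; rewrite we.
Qed.

(* This depends on [n]; it is a suffix of the least de Bruijn word of order [n],
   seen as the concatenation of the Lyndon words of length dividing [n]. *)
Definition K (n m : nat) : word := flatten [seq ell n i | i <- rev (iota 0 m.+1)].

Local Open Scope ring_scope.

Definition sk (w : word) : int :=
  (count_mem false w)%:Z - (count_mem true w)%:Z.

(* [mstep_hist m init n] lists the terms of index < n of the sequence with
   initial terms [init 0], ..., [init m.-1] in which each later term is the sum
   of the [m] preceding ones; see [mstepE]. *)
Fixpoint mstep_hist (m : nat) (init : nat -> int) (n : nat) : seq int :=
  if n is n'.+1 then
    let s := mstep_hist m init n' in
    rcons s (if (n' < m)%N then init n'
             else \sum_(1 <= i < m.+1) s`_(n' - i))
  else [::].

Definition mstep (m : nat) (init : nat -> int) (n : nat) : int :=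
  (mstep_hist m init n.+1)`_n.

Definition G (m n : nat) : int := mstep m (fun=> 1) n.

Definition H (m n : nat) : int :=
  mstep m (fun i => if i == 0%N then m%:Z else 2 ^+ i - 1) n.

Lemma size_mstep_hist m init n : size (mstep_hist m init n) = n.
Proof. by elim: n => //= n IH; rewrite size_rcons IH. Qed.

Lemma nth_mstep_hist m init n k :
  (k < n)%N -> (mstep_hist m init n)`_k = mstep m init k.
Proof.
elim: n => // n IH; rewrite ltnS leq_eqVlt => /predU1P[-> //|kn].
by rewrite /= nth_rcons size_mstep_hist kn IH.
Qed.

Lemma mstepE m init n :
  mstep m init n = if (n < m)%N then init n
                   else \sum_(1 <= i < m.+1) mstep m init (n - i).
Proof.
rewrite /mstep /= nth_rcons size_mstep_hist ltnn eqxx.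
case: ltnP => // mn; rewrite !big_nat; apply: eq_bigr => i /andP[i0 im].
apply: nth_mstep_hist; rewrite ltn_subrL i0 (leq_trans _ mn) //.
by apply: leq_trans i0 _.
Qed.

Lemma G_init m n : (n < m)%N -> G m n = 1.
Proof. by move=> nm; rewrite /G mstepE nm. Qed.

Lemma G_rec m n : (m <= n)%N -> G m n = \sum_(1 <= i < m.+1) G m (n - i).
Proof. by move=> mn; rewrite /G mstepE ltnNge mn. Qed.

Lemma H_init0 m : (0 < m)%N -> H m 0 = m%:Z.
Proof. by move=> m0; rewrite /H mstepE m0. Qed.

Lemma H_init m n : (1 <= n < m)%N -> H m n = 2 ^+ n - 1.
Proof. by case: n => // n /andP[_ nm]; rewrite /H mstepE nm. Qed.

Lemma H_rec m n : (m <= n)%N -> H m n = \sum_(1 <= i < m.+1) H m (n - i).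
Proof. by move=> mn; rewrite /H mstepE ltnNge mn. Qed.

(* Main.v *)
Require Import Defs.
From HB Require Import structures.
From mathcomp Require Import all_boot all_order all_algebra.
From mathcomp Require Import zify.

(** Call a word [w] admissible when its infinite repetition [w w w ...] has no
    [m+1] consecutive zeros; this excludes the words without a [1].
    The key fact ([perm_K_heads]) is that the letters of [K n m] are, up to order,
    the first letters of all the admissible words of length [n].
    Indeed [K n m] is the concatenation of the Lyndon words [u] with [size u]
    dividing [n], other than the word [0], which avoid [0^(m+1)].
    Every nonempty word [w] is, in exactly one way, a power of a rotation [rot k u]
    of a Lyndon word [u] with [k < size u], and the first letter of that power is
    the [k]-th letter of [u].  Moreover [w] is admissible exactly when [u] is, and
    since a Lyndon word other than [0] ends with [1], none of its cyclic runs of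
    zeros wraps around: [u] is admissible exactly when it avoids [0^(m+1)].

    So the length of [K n m] is the number of admissible words of length [n], and
    its skew is the number of those which start with [0] minus the number of
    those which start with [1].  Both are counted with two families of numbers:
    [num_avoids m a k] counts the words [v] of length [k] such that [0^a v] avoids
    [0^(m+1)], and [num_cyc m a k] counts those such that [v 0^a] is admissible.
    Reading the first letter of [v] gives first-order recurrences in [k] which
    mix the values of [a] ([num_avoidsS], [num_cycS]); an induction turns them
    into recurrences over the last [m+1] terms for each fixed [a]
    ([num_avoids_window], [num_cyc_window]).  Finally
    [H m.+1 n = num_cyc m 0 n] for [n > 0], and
    [G m.+1 k = num_avoids m 0 k - num_cyc m 1 k], because both sides have the
    same recurrence and the same initial terms, except that the value of H at
    index 0 replaces a correction term of the first recurrence. *)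

Set Implicit Arguments.
Unset Strict Implicit.
Unset Printing Implicit Defensive.

Import Order.TTheory GRing.Theory Num.Theory.

(** * Powers, rotations and periods *)

Lemma powS u r : pow u r.+1 = u ++ pow u r.
Proof. by []. Qed.

Lemma pow_neq_nil u r : pow u r <> [::] -> u <> [::].
Proof. by move=> uN u0; apply: uN; apply: size0nil; rewrite size_pow u0 muln0. Qed.

Lemma pow_mul u r s : pow (pow u r) s = pow u (s * r).
Proof.
elim: s => // s IH; rewrite powS IH mulSn /pow nseqD flatten_cat //.
Qed.

Lemma pow_catC u r : pow u r ++ u = u ++ pow u r.
Proof. by elim: r => [|r IH]; rewrite ?cats0 // powS -catA IH. Qed.

(** Iterates of [rot 1] compose without any bound on the number of letters moved,
    unlike [rot]. *)
Lemma rot_iter (T : Type) k (x : seq T) : k <= size x -> rot k x = iter k (rot 1) x.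
Proof.
elim: k => [|k IH] kx; first exact: rot0.
by rewrite rotS //= IH // ltnW.
Qed.

Lemma pow_cons_rcons a u r : pow (a :: u) r ++ [:: a] = a :: pow (rcons u a) r.
Proof. by elim: r => //= r IH; rewrite !powS -catA IH -cats1 -catA. Qed.

Lemma rot1_pow u r : rot 1 (pow u r) = pow (rot 1 u) r.
Proof.
have pow_nil s : pow [::] s = [::] by elim: s.
case: u r => [|a u] [|r]; rewrite ?pow_nil //.
rewrite !powS cat_cons !rot1_cons -cats1 -catA pow_cons_rcons.
by rewrite cat_rcons.
Qed.

Lemma iter_rot_pow k u r : iter k (rot 1) (pow u r) = pow (iter k (rot 1) u) r.
Proof. by elim: k => //= k ->; rewrite rot1_pow. Qed.

(** Bezout: iterating [a * p] times or [b * q + gcdn p q] times is the same. *)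
Lemma iter_fix_gcd (T : Type) (f : T -> T) (x : T) p q :
  iter p f x = x -> iter q f x = x -> iter (gcdn p q) f x = x.
Proof.
have mulfix s k : iter s f x = x -> iter (k * s) f x = x.
  by move=> fx; elim: k => // k IH; rewrite mulSn iterD IH.
case: p => [|p] px qx; first by rewrite gcd0n.
case: (egcdnP q (ltn0Sn p)) => a b ab _.
have := mulfix _ a px; rewrite ab addnC iterD mulfix //.
Qed.

(** A case of the theorem on commuting words: since [y] is a prefix of [y z = z y]
    and [size z] is a multiple of [size y], copies of [y] can be split off [z]. *)
Lemma commute_pow r (y z : word) :
  size z = r * size y -> z ++ y = y ++ z -> z = pow y r.
Proof.
elim: r z => [|r IH] z sz zy; first exact: size0nil.
have zE : z = y ++ drop (size y) z.
  have := congr1 (take (size y)) zy.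
  rewrite [RHS]take_size_cat // takel_cat ?sz ?mulSn ?leq_addr // => yE.
  by rewrite -{1}(cat_take_drop (size y) z) yE.
rewrite powS zE; congr (_ ++ _); apply: IH.
  by rewrite size_drop sz mulSn addKn.
move: zy; rewrite {1 2}zE -catA => /eqP; rewrite eqseq_cat // eqxx /=.
by move/eqP->.
Qed.

Lemma rot_fix_pow g (x : word) : g %| size x -> rot g x = x ->
  x = pow (take g x) (size x %/ g).
Proof.
move=> gx rx; have [->|x0] := eqVneq x [::]; first by rewrite div0n.
have s0 : 0 < size x by rewrite lt0n size_eq0.
have gs := dvdn_leq s0 gx; have g0 : 0 < g := dvdn_gt0 s0 gx.
have /divnK xE := gx; have st := size_takel gs.
move: xE; case: (size x %/ g) => [|r] xE; first by rewrite -xE in s0.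
rewrite powS -{1}(cat_take_drop g x); congr (_ ++ _); apply: commute_pow.
  by rewrite st size_drop -xE mulSn addKn.
by rewrite cat_take_drop.
Qed.

Lemma aperiodic_rot k u : aperiodic u -> aperiodic (rot k u).
Proof.
move=> au [v [r [r2 uE]]]; apply: au.
exists (iter (size u - k) (rot 1) v), r; split=> //.
rewrite -iter_rot_pow -uE -rot_iter ?size_rot ?leq_subr //.
by rewrite -{1}(rotK k u) /rotr size_rot.
Qed.

(** The length of an aperiodic word is the only one of its divisors that is a
    period of its powers: a shorter period [g] would make [u] the power of its
    prefix of length [g]. *)
Lemma aperiodic_period u r g : aperiodic u -> u <> [::] -> 0 < r ->
  g %| size u -> rot g (pow u r) = pow u r -> g = size u.
Proof.
move=> au u0 r0 gu gx; have s0 : 0 < size u by rewrite lt0n size_eq0; apply/eqP.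
have gs := dvdn_leq s0 gu; have g0 : 0 < g := dvdn_gt0 s0 gu.
have gx' : g %| size (pow u r) by rewrite size_pow dvdn_mull.
have ux := rot_fix_pow gx' gx.
case: r r0 gx gx' ux => // r _ gx gx' ux.
have tE : take g (pow u r.+1) = take g u by rewrite powS takel_cat.
have uE : u = pow (take g u) (size u %/ g).
  have := congr1 (take (size u)) ux; rewrite {1}powS take_size_cat // tE => {1}->.
  rewrite size_pow mulSn divnDl // /pow nseqD flatten_cat take_size_cat //.
  by rewrite -/(pow _ _) size_pow size_takel // divnK.
have := divnK gu; case: (size u %/ g) uE (divn_gt0 (size u) g0) => [|[|k]] uE.
- by rewrite gs.
- by rewrite mul1n.
by case: au; exists (take g u), k.+2.
Qed.

(** Both lengths are periods of the common power, hence so is their gcd, which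
    must then equal each of them. *)
Lemma pow_aperiodic_size u v r s : aperiodic u -> aperiodic v ->
  u <> [::] -> v <> [::] -> 0 < r -> 0 < s -> pow u r = pow v s -> size u = size v.
Proof.
have fixed w k : 0 < k -> iter (size w) (rot 1) (pow w k) = pow w k.
  move=> k0; rewrite -rot_iter ?size_pow ?leq_pmull //.
  by case: k k0 => // k _; rewrite powS rot_size_cat pow_catC.
move=> au av u0 v0 r0 s0 E.
have fu := fixed u r r0; have fv := fixed v s s0; rewrite -E in fv.
have fg := iter_fix_gcd fu fv.
have gu : gcdn (size u) (size v) <= size (pow u r).
  apply: leq_trans (dvdn_leq _ (dvdn_gcdl _ _)) _; last first.
    by rewrite size_pow leq_pmull.
  by rewrite lt0n size_eq0; apply/eqP.
rewrite -rot_iter // in fg.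
rewrite -(aperiodic_period au u0 r0 (dvdn_gcdl _ _) fg).
by apply: (aperiodic_period av v0 s0 (dvdn_gcdr _ _)); rewrite -E.
Qed.

Lemma pow_aperiodic_inj u v r s : aperiodic u -> aperiodic v ->
  u <> [::] -> v <> [::] -> 0 < r -> 0 < s -> pow u r = pow v s -> u = v.
Proof.
move=> au av u0 v0 r0 s0 E; have sE := pow_aperiodic_size au av u0 v0 r0 s0 E.
move: E; case: r r0 => // r _; case: s s0 => // s _.
by rewrite !powS => /eqP; rewrite eqseq_cat // => /andP[/eqP].
Qed.

(** If the rotations by [j < k] agree, then [k - j] is a period of [u], and so is
    its gcd with [size u], which is too small. *)
Lemma aperiodic_rot_inj u j k : aperiodic u -> j < size u -> k < size u ->
  rot j u = rot k u -> j = k.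
Proof.
move=> au; wlog jk : j k / j <= k.
  by move=> W jl kl E; case/orP: (leq_total j k) => jk; [|symmetry]; apply: W.
move=> jl kl E; apply/eqP; rewrite eqn_leq jk /=.
apply: contraT; rewrite -ltnNge => {}jk.
have u0 : u <> [::] by move=> u0; rewrite u0 in jl.
have dj : iter (k - j) (rot 1) u = u.
  rewrite -rot_iter; last by lia.
  apply: (@rot_inj j); rewrite E rot_add_mod; try lia.
  by rewrite subnKC 1?ltnW // (ltnW kl).
have fu : iter (size u) (rot 1) u = u by rewrite -rot_iter ?rot_size.
have fg := iter_fix_gcd dj fu.
have gl : gcdn (k - j) (size u) <= k - j by apply: dvdn_leq (dvdn_gcdl _ _); lia.
rewrite -rot_iter in fg; last by lia.
have := @aperiodic_period u 1 _ au u0 isT (dvdn_gcdr (k - j) (size u)).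
rewrite /pow /= cats0 => /(_ fg); lia.
Qed.

Lemma rot_comp (T : Type) i j (x : seq T) : exists k, rot i (rot j x) = rot k x.
Proof.
have [ix|/ltnW ix] := leqP i (size (rot j x)); last first.
  by exists j; rewrite rot_oversize.
have [jx|/ltnW jx] := leqP j (size x); last first.
  by exists i; rewrite (rot_oversize jx).
by rewrite size_rot in ix; rewrite rot_add_mod //; eexists.
Qed.

Lemma rot_undo (T : Type) j (x : seq T) : exists k, rot k (rot j x) = x.
Proof. by exists (size (rot j x) - j); apply: rotK. Qed.

(** Each of the two words is a least rotation of the other. *)
Lemma lyndon_rot_inj u v j k : lyndon u -> lyndon v ->
  rot j u = rot k v -> u = v.
Proof.
have le_rot x y i l : lyndon x -> rot i x = rot l y -> lexle x y.
  move=> [_ _ lx] E; have [l' <-] := rot_undo l y.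
  by rewrite -E; have [i' ->] := rot_comp l' i x.
move=> lu lv E; apply: (@le_anti _ (seqlexi bool)).
by apply/andP; split; [apply: le_rot E|apply: le_rot (esym E)].
Qed.

(** A word that is not aperiodic is a power of a shorter word; induct on length.
    The finite test of [lyndonb] decides which case holds. *)
Lemma exists_aperiodic_root (w : word) : w <> [::] ->
  exists v r, [/\ aperiodic v, v <> [::], 0 < r & w = pow v r].
Proof.
have [n] := ubnP (size w); elim: n w => // n IH w wn w0.
have [wap|] :=
  boolP (all (fun r => w != pow (take (size w %/ r) w) r) (iota 2 (size w))).
  exists w, 1; split=> //; last by rewrite /pow /= cats0.
  move=> [u [r [r2 wE]]].
  have u0 : u <> [::] by apply: (@pow_neq_nil u r); rewrite -wE.
  have su : 0 < size u by rewrite lt0n size_eq0; apply/eqP.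
  have r_in : r \in iota 2 (size w).
    by rewrite mem_iota r2 wE size_pow add2n ltnS ltnW // ltnS leq_pmulr.
  have /eqP := allP wap r r_in; apply.
  have -> : size w %/ r = size u by rewrite wE size_pow mulKn ?(leq_trans _ r2).
  suff -> : take (size u) w = u by [].
  by rewrite wE -(subnKC r2) powS take_size_cat.
case/allPn => r; rewrite mem_iota negbK => /andP[r2 _] /eqP wE.
set u := take _ _ in wE.
have u0 : u <> [::] by apply: (@pow_neq_nil u r); rewrite -wE.
have su : 0 < size u by rewrite lt0n size_eq0; apply/eqP.
have [|v [s [av v0 s0 uE]]] := IH u _ u0.
  by rewrite -ltnS (leq_trans _ wn) // ltnS wE size_pow; nia.
exists v, (r * s); split=> //; first by rewrite muln_gt0 s0 (leq_trans _ r2).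
by rewrite -pow_mul -uE.
Qed.

(** Take the lexicographically least rotation. *)
Lemma lyndon_rot_exists v : aperiodic v -> v <> [::] ->
  exists2 u, lyndon u & exists2 k, k < size u & v = rot k u.
Proof.
move=> av v0; have s0 : 0 < size v by rewrite lt0n size_eq0; apply/eqP.
case: (arg_minP (fun i : 'I_(size v) => (rot i v : seqlexi bool))
                (erefl : xpredT (Ordinal s0))).
move=> i _ imin; exists (rot i v).
  split; [|exact: aperiodic_rot|].
    by move=> /(congr1 size); rewrite size_rot => /size0nil.
  move=> k; have [j ->] := rot_comp k i v.
  have [jv|/rot_oversize->] := ltnP j (size v); first exact: (imin (Ordinal jv)).
  by rewrite -[v in X in lexle _ X]rot0; apply: (imin (Ordinal s0)).
have [k kE] := rot_undo i v.
have [kv|kv] := ltnP k (size v); first by exists k; rewrite ?size_rot.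
exists 0; rewrite ?size_rot // rot0.
by rewrite rot_oversize ?size_rot in kE.
Qed.

(** * Words without long runs of zeros *)

Definition avoids (m : nat) (w : word) : bool := ~~ infix (zeros m.+1) w.

(** Every window of [m+1] cyclically consecutive letters contains a [1].  The
    bound [(size w).+1] on its starting point leaves one window for the empty
    word, which is thereby excluded, like all the words without a [1]. *)
Definition cyc_avoids (m : nat) (w : word) : bool :=
  [forall j : 'I_(size w).+1, exists i : 'I_m.+1, nth false w ((j + i) %% size w)].

Lemma cyc_avoidsP m w :
  reflect (forall j, exists2 i, i <= m & nth false w ((j + i) %% size w))
          (cyc_avoids m w).
Proof.
apply: (iffP forallP) => [av j|av j]; last first.
  by have [i im wi] := av j; apply/existsP; exists (Ordinal (im : i < m.+1)).
have jl : j %% size w < (size w).+1.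
  case: w av => [|a w] av; last by rewrite ltnS ltnW ?ltn_mod.
  by have /existsP[i] := av ord0; rewrite nth_nil.
have /existsP[i] := av (Ordinal jl); rewrite /= modnDml => wi.
by exists i => //; rewrite -ltnS.
Qed.

Lemma nth_rot1 (w : word) j :
  nth false (rot 1 w) (j %% size w) = nth false w (j.+1 %% size w).
Proof.
case: w => [|a w] /=; first by rewrite !nth_nil.
rewrite rot1_cons nth_rcons -[j.+1]addn1 -modnDml.
have := ltn_pmod j (ltn0Sn (size w)); set k := j %% _ => kw.
have [kl|lk] := ltnP k (size w); first by rewrite modn_small addn1.
have -> : k = size w by lia.
by rewrite eqxx addn1 modnn.
Qed.

Lemma cyc_avoids_rot m k w : cyc_avoids m (rot k w) = cyc_avoids m w.
Proof.
suff imp i x : cyc_avoids m x -> cyc_avoids m (rot i x).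
  by apply/idP/idP => [|/imp //]; have [i {2}<-] := rot_undo k w; apply: imp.
wlog ix : i / i <= size x.
  by move=> W; have [/W//|/ltnW/rot_oversize->] := leqP i (size x).
rewrite rot_iter //; elim: i {ix} => //= i IH /IH; move: (iter _ _ _) => {IH x}x.
move=> /cyc_avoidsP av; apply/cyc_avoidsP => j; have [l lm xl] := av j.+1.
by exists l => //; rewrite size_rot nth_rot1 -addSn.
Qed.

Lemma nth_pow (w : word) r i : i < r * size w ->
  nth false (pow w r) i = nth false w (i %% size w).
Proof.
elim: r i => // r IH i; rewrite mulSn => il; rewrite powS nth_cat.
have [iw|wi] := ltnP i (size w); first by rewrite modn_small.
by rewrite IH; [rewrite -{2}(subnK wi) modnDr|lia].
Qed.

Lemma cyc_avoids_pow m w r : 0 < r -> cyc_avoids m (pow w r) = cyc_avoids m w.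
Proof.
move=> r0; have E j : nth false (pow w r) (j %% size (pow w r)) =
                      nth false w (j %% size w).
  rewrite size_pow; have [w0|w0] := posnP (size w).
    by rewrite (size0nil w0) !nth_default //= size_pow muln0.
  by rewrite nth_pow ?ltn_mod ?muln_gt0 ?r0 // modn_dvdm ?dvdn_mull.
by apply/cyc_avoidsP/cyc_avoidsP => av j; have [i im] := av j;
  exists i; rewrite ?E // -E.
Qed.

Lemma avoids_rcons m w : avoids m (rcons w true) = avoids m w.
Proof.
rewrite /avoids -[in LHS]infix_rev -[in RHS]infix_rev rev_rcons.
by rewrite rev_nseq.
Qed.

(** After a final [1] no cyclic run of zeros wraps around the end of the word. *)
Lemma cyc_avoids_rcons m w : cyc_avoids m (rcons w true) = avoids m w.
Proof.
apply/cyc_avoidsP/idP => [av|av j].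
  apply/negP => /infixP[p [s wE]]; have [i im] := av (size p).
  have sw : size w = size p + m.+1 + size s by rewrite wE !size_cat size_nseq addnA.
  rewrite size_rcons modn_small ?sw; last by lia.
  rewrite nth_rcons sw ifT; last by lia.
  rewrite wE nth_cat ltnNge leq_addr addKn nth_cat size_nseq ltnS im.
  by rewrite nth_nseq ltnS im.
rewrite size_rcons; set k := j %% (size w).+1.
have kw : k < (size w).+1 by rewrite ltn_mod.
have [wk|kw'] := leqP (size w) (k + m).
  exists (size w - k); first by lia.
  by rewrite -modnDml -/k subnKC // modn_small // nth_rcons ltnn eqxx.
have [/existsP[i wi]|/existsPn w0] :=
  boolP [exists i : 'I_m.+1, nth false w (k + i)].
  exists i; first by rewrite -ltnS.
  have im := ltn_ord i; rewrite -modnDml -/k modn_small; last by lia.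
  by rewrite nth_rcons ifT //; lia.
case/negP: av; apply/infixP; exists (take k w), (drop (k + m.+1) w).
rewrite -{1}(cat_take_drop k w) -{1}(cat_take_drop m.+1 (drop k w)).
rewrite drop_drop [m.+1 + k]addnC.
congr (_ ++ (_ ++ _)); apply: (@eq_from_nth _ false).
  by rewrite size_nseq size_takel // size_drop; lia.
move=> i; rewrite size_takel ?size_drop; last by lia.
move=> im; rewrite nth_take // nth_drop nth_nseq im.
by apply/negbTE/(w0 (Ordinal im)).
Qed.

(** The first letter of [w] must be [0]; cancelling it on both sides leaves the
    same inequality for the rest of [w]. *)
Lemma lexle_rcons_false w :
  lexle (rcons w false) (false :: w) -> w = zeros (size w).
Proof.
rewrite /lexle; elim: w => //= a w IH; rewrite lexi_cons => /andP[].
by case: a => //= _ /IH <-.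
Qed.

Lemma pow_letter (a : bool) k : pow [:: a] k = nseq k a.
Proof. by elim: k => //= k <-. Qed.

Lemma aperiodic_nseq (a : bool) k :
  0 < k -> aperiodic (nseq k a) -> nseq k a = [:: a].
Proof.
case: k => [|[|k]] // _ ap; case: ap; exists [:: a], k.+2; split => //.
by rewrite pow_letter.
Qed.

(** If [w = v 0], then [v 0 <= 0 v] by minimality, so that [w] contains only
    zeros and is aperiodic only if it is the word [0]. *)
Lemma lyndon_last w : lyndon w -> w <> [:: false] -> exists v, w = rcons v true.
Proof.
case/lastP: w => [[]//|v [] [_ ap lw] wf]; first by exists v.
case: wf; have := lw (size v).
rewrite -cats1 rot_size_cat cats1 => /lexle_rcons_false vE.
suff E : rcons v false = nseq (size v).+1 false.
  by rewrite E in ap *; apply: aperiodic_nseq.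
by rewrite {1}vE -cats1 -[[:: false]]/(nseq 1 false) -nseqD addn1.
Qed.

Lemma lyndon_cyc_avoids m w : lyndon w -> w <> [:: false] ->
  cyc_avoids m w = avoids m w.
Proof.
move=> lw wf; have [v ->] := lyndon_last lw wf.
by rewrite cyc_avoids_rcons avoids_rcons.
Qed.

Lemma cyc_avoids_falses m k : cyc_avoids m (zeros k) = false.
Proof.
by apply/cyc_avoidsP => /(_ 0)[i _]; rewrite nth_nseq; case: ifP.
Qed.

(** * The factors of [K n m] *)

Definition ell_factors (n i : nat) : seq word :=
  if i == 0 then [:: [:: true]] else if i <= n.-1 then ell_words n i else [::].

Fixpoint K_factors (n m : nat) : seq word :=
  if m is m'.+1 then ell_factors n m ++ K_factors n m' else ell_factors n 0.

Lemma K_flatten n m : K n m = flatten (K_factors n m).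
Proof.
have ellE i : ell n i = flatten (ell_factors n i).
  by rewrite /ell /ell_factors; case: ifP => // _; case: ifP.
elim: m => [|m IH]; first by [].
have -> : K n m.+1 = ell n m.+1 ++ K n m.
  rewrite /K -[m.+2]addn1 iotaD rev_cat map_cat flatten_cat.
  by congr (_ ++ _); apply: cats0.
by rewrite ellE IH -flatten_cat.
Qed.

Lemma lyndon_true : lyndon [:: true].
Proof.
split=> // [[u [r [r2 /(congr1 size)]]]|[|k]]; last 2 first.
- exact: lexx.
- by rewrite rot_oversize //; apply: lexx.
by rewrite size_pow /=; case: (size u) => [|k]; nia.
Qed.

Lemma avoids_mono i m w : i <= m -> avoids i w -> avoids m w.
Proof.
move=> im; apply: contra; apply: infix_trans.
by rewrite -(subnK im) -addnS addnC /zeros nseqD prefix_infix.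
Qed.

(** This merges the two special features of [ell]: for [i = 0] the only Lyndon
    word without a zero is [1], and for [i > n.-1] there is nothing to list,
    since [0^i] followed by a final [1] would be longer than [n]. *)
Lemma mem_ell_factors n i w : 0 < n ->
  w \in ell_factors n i =
  [&& lyndonb w, size w %| n, w != [:: false], avoids i w
    & (0 < i) ==> ~~ avoids i.-1 w].
Proof.
move=> n0; rewrite /ell_factors; case: i => [|i] /=.
  rewrite mem_seq1 andbT; apply/eqP/and4P => [->|[/lyndonP lw _ /eqP wf w0]].
    by split; rewrite // ?dvd1n //; apply/lyndonP/lyndon_true.
  have wE : w = nseq (size w) true.
    apply/all_pred1P/allP => -[] // wF; case/negP: w0.
    by rewrite (infix1s w false).
  case: lw => wN0 ap _; rewrite wE in ap wN0 *.
  by apply: aperiodic_nseq ap; case: (size w) wN0.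
have -> : (w \in (if i < n.-1 then ell_words n i.+1 else [::])) =
          (i < n.-1) && (w \in ell_words n i.+1) by case: ifP.
rewrite mem_ell_words // /avoids negbK.
apply/idP/idP => [/and5P[i1 s1 sn lw /andP[z0 z1]]|/and5P[lw sn /eqP wf z1 z0]].
  by rewrite lw sn z0 z1 !andbT /=; apply: contraTneq s1 => ->.
have sw : i.+1 < size w.
  have [v wE] := lyndon_last (elimT (lyndonP w) lw) wf.
  move: (z0); rewrite -[infix _ _]negbK -/(avoids i w) wE avoids_rcons negbK.
  by move=> /size_infix; rewrite size_nseq size_rcons.
have := dvdn_leq n0 sn; move: (size w) sn sw => k sn sw kn.
by rewrite lw sn z0 z1 /= !andbT; apply/andP; split; lia.
Qed.

(** The longest run of zeros has some length [i <= m], which tells the unique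
    [ell n i] where the word occurs. *)
Lemma mem_K_factors n m w : 0 < n ->
  w \in K_factors n m = [&& lyndonb w, size w %| n, w != [:: false] & avoids m w].
Proof.
move=> n0; elim: m => [|m IH] /=; first by rewrite mem_ell_factors //= andbT.
rewrite mem_cat IH mem_ell_factors //=.
have := @avoids_mono m m.+1 w (leqnSn m).
case: (avoids m w) => [/(_ isT)->|_]; first by rewrite !andbF.
by rewrite !andbF orbF andbT.
Qed.

Lemma K_factors_uniq n m : 0 < n -> uniq (K_factors n m).
Proof.
move=> n0; elim: m => [|m IH] //=; rewrite cat_uniq IH andbT; apply/andP; split.
  by rewrite /ell_factors /=; case: ifP => // _; apply: ell_words_uniq.
apply/hasPn => w; rewrite mem_K_factors // => /and4P[_ _ _ av].
by rewrite mem_ell_factors //= av !andbF.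
Qed.

Definition admissible_words (n m : nat) : seq word :=
  [seq w <- words n | cyc_avoids m w].

Lemma words_uniq n : uniq (words n).
Proof. by rewrite map_inj_uniq ?enum_uniq //; apply: val_inj. Qed.

(** Every admissible word is, in exactly one way, a power of a rotation of a
    factor of [K n m]. *)
Lemma perm_admissible_words n m : 0 < n ->
  perm_eq [seq pow (rot k u) (n %/ size u)
              | u <- K_factors n m, k <- iota 0 (size u)]
          (admissible_words n m).
Proof.
move=> n0; have factP u : u \in K_factors n m ->
    [/\ lyndon u, size u %| n, 0 < size u, 0 < n %/ size u & cyc_avoids m u].
  rewrite mem_K_factors // => /and4P[/lyndonP lu un /eqP uf av].
  have s0 : 0 < size u by rewrite lt0n size_eq0; case: lu => /eqP.
  by rewrite lyndon_cyc_avoids //; split=> //; rewrite divn_gt0 // dvdn_leq.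
apply: uniq_perm.
- (* No power of a rotation is listed twice. *)
  apply: allpairs_uniq_dep => [|u _|]; [exact: K_factors_uniq|exact: iota_uniq|].
  move=> x y /allpairsPdep[u [k [/factP[lu un s0 r0 _] ku ->]]].
  move=> /allpairsPdep[v [l [/factP[lv vn t0 s0' _] lv' ->]]] /= E.
  have [uN apu _] := lu; have [vN apv _] := lv.
  have rotN0 (x0 : word) j : x0 <> [::] -> rot j x0 <> [::].
    by move=> xN /(congr1 size); rewrite size_rot => /size0nil.
  have {}E := pow_aperiodic_inj (aperiodic_rot apu) (aperiodic_rot apv)
    (@rotN0 u k uN) (@rotN0 v l vN) r0 s0' E.
  have uv := lyndon_rot_inj lu lv E; subst v.
  rewrite !mem_iota /= !add0n in ku lv'.
  by rewrite (aperiodic_rot_inj apu ku lv' E).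
- exact/filter_uniq/words_uniq.
move=> w; rewrite mem_filter mem_words; apply/allpairsPdep/andP.
  move=> [u [k [/factP[lu un s0 r0 cu] _ ->]]].
  by rewrite cyc_avoids_pow // cyc_avoids_rot cu size_pow size_rot divnK.
move=> [cw /eqP sw]; have w0 : w <> [::] by move=> w0; rewrite -sw w0 in n0.
have [v [r [av v0 r0 wE]]] := exists_aperiodic_root w0.
have [u lu [k ku vE]] := lyndon_rot_exists av v0.
rewrite wE cyc_avoids_pow // vE cyc_avoids_rot in cw.
have nE : n = r * size u by rewrite -sw wE size_pow vE size_rot.
rewrite nE in n0 *; exists u, k.
rewrite mem_iota add0n ku mulnK ?(leq_ltn_trans _ ku) // -vE; split=> //.
have uf : u <> [:: false].
  by move=> uf; move: cw; rewrite uf (cyc_avoids_falses m 1).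
rewrite mem_K_factors // -lyndon_cyc_avoids // cw dvdn_mull //= andbT.
by apply/andP; split; [apply/lyndonP|apply/eqP].
Qed.

(** The powers of the rotations of [u] start with the successive letters of
    [u], so that taking first letters turns the list of [perm_admissible_words]
    into [K n m]. *)
Lemma perm_K_heads n m : 0 < n ->
  perm_eq (K n m) [seq head false w | w <- admissible_words n m].
Proof.
move=> n0; rewrite perm_sym; apply: perm_trans (perm_map _ (_ : perm_eq _ _)) _.
  by rewrite perm_sym; apply: perm_admissible_words.
rewrite map_allpairs K_flatten.
suff -> : flatten [seq [seq head false (pow (rot k u) (n %/ size u))
                           | k <- iota 0 (size u)] | u <- K_factors n m] =
           flatten (K_factors n m) by [].
congr flatten; rewrite -[RHS]map_id; apply/eq_in_map => u uK.
move: uK; rewrite mem_K_factors // => /and4P[_ un _ _].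
rewrite -[RHS](mkseq_nth false) /mkseq; apply/eq_in_map => k.
rewrite mem_iota add0n => /= ku.
have r0 : 0 < n %/ size u by rewrite divn_gt0 ?(leq_ltn_trans _ ku) // dvdn_leq.
case: (n %/ size u) r0 => // r _.
rewrite powS -nth0 nth_cat size_rot (leq_ltn_trans _ ku) //.
by rewrite /rot nth_cat size_drop subn_gt0 ku nth_drop addn0.
Qed.

(** * Counting words by their first letter *)

Lemma count_wordsS (P : pred word) k :
  count P (words k.+1) =
  count (fun v => P (true :: v)) (words k) +
  count (fun v => P (false :: v)) (words k).
Proof.
have cons_inj (b : bool) : injective (cons b) by move=> ? ? [].
have E : perm_eq (words k.+1)
                 (map (cons true) (words k) ++ map (cons false) (words k)).
  apply: uniq_perm; first exact: words_uniq.
    rewrite cat_uniq !(map_inj_uniq (@cons_inj _)) words_uniq andbT.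
    by apply/hasPn => _ /mapP[v _ ->]; apply/mapP => -[].
  move=> w; rewrite mem_cat mem_words.
  apply/eqP/orP => [|[] /mapP[v + ->]]; last 2 first.
  - by rewrite mem_words => /eqP <-.
  - by rewrite mem_words => /eqP <-.
  case: w => [//|[] w] [wk]; [left|right];
    by rewrite (mem_map (@cons_inj _)) mem_words wk.
by rewrite (seq.permP E) count_cat !count_map.
Qed.

Lemma count_words_rev (P : pred word) k :
  count (fun v => P (rev v)) (words k) = count P (words k).
Proof.
rewrite -(count_map rev); apply/seq.permP/uniq_perm.
- by rewrite map_inj_uniq ?words_uniq //; apply: can_inj (@revK _).
- exact: words_uniq.
move=> w; rewrite -{1}(revK w) mem_map ?mem_words ?size_rev //.
exact: can_inj (@revK _).
Qed.

Lemma count_words0 (P : pred word) : count P (words 0) = P [::].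
Proof.
have /perm_small_eq-> // : perm_eq (words 0) [:: [::]].
  apply: uniq_perm => //; first exact: words_uniq.
  by move=> w; rewrite mem_words mem_seq1 size_eq0.
by rewrite /= addn0.
Qed.

Lemma avoids_zeros m a : avoids m (zeros a) = (a <= m).
Proof.
have [am|ma] := leqP a m.
  by apply/negP => /size_infix; rewrite !size_nseq; lia.
by apply/negbF/infixP; exists [::], (zeros (a - m.+1)); rewrite -nseqD subnKC.
Qed.

Lemma prefix_zeros k a v : prefix (zeros k) (zeros a ++ true :: v) = (k <= a).
Proof. by elim: k a => [|k IH] [|a] //=; apply: IH. Qed.

Lemma avoids_zeros_true m a v :
  avoids m (zeros a ++ true :: v) = (a <= m) && avoids m v.
Proof.
elim: a => [|a IH] //; rewrite /avoids in IH *.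
rewrite cat_cons infix_consl -cat_cons (prefix_zeros _ a.+1) negb_or IH -leqNgt.
by case: ltnP => //= am; rewrite ltnW.
Qed.

Lemma avoids_rev m w : avoids m (rev w) = avoids m w.
Proof. by rewrite /avoids -{1}[zeros _]revK rev_nseq infix_rev. Qed.

(** * The two families of counts *)

Section Counts.
Variable m : nat.

Definition num_avoids a k := count (fun v => avoids m (zeros a ++ v)) (words k).
Definition num_cyc a k := count (fun v => cyc_avoids m (v ++ zeros a)) (words k).

Lemma zeros_catS a v : zeros a ++ false :: v = zeros a.+1 ++ v.
Proof. by elim: a => //= a ->. Qed.

Lemma num_avoids0 a : num_avoids a 0 = (a <= m).
Proof. by rewrite /num_avoids count_words0 cats0 avoids_zeros. Qed.

Lemma num_avoidsS a k :
  num_avoids a k.+1 = (a <= m) * num_avoids 0 k + num_avoids a.+1 k.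
Proof.
rewrite /num_avoids count_wordsS; congr (_ + _); last first.
  by apply: eq_count => v; rewrite zeros_catS.
under eq_count do rewrite avoids_zeros_true.
by case: (a <= m); rewrite ?mul1n // mul0n (eq_count (a2 := pred0)) ?count_pred0.
Qed.

Lemma num_cyc0 a : num_cyc a 0 = 0.
Proof. by rewrite /num_cyc count_words0 cyc_avoids_falses. Qed.

(** Rotating the initial [1] to the end turns the cyclic condition into a linear
    one on [v 0^a], whose mirror image is the condition on [0^a (rev v)]. *)
Lemma count_cyc_true a k :
  count (fun v => cyc_avoids m (true :: v ++ zeros a)) (words k) = num_avoids a k.
Proof.
rewrite /num_avoids -(count_words_rev (fun v => avoids m (zeros a ++ v))).
apply: eq_count => v; rewrite -(cyc_avoids_rot m 1) rot1_cons cyc_avoids_rcons.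
by rewrite -avoids_rev rev_cat rev_nseq.
Qed.

(** The initial [0] rotates to the end, where it joins the block [0^a]. *)
Lemma count_cyc_false a k :
  count (fun v => cyc_avoids m (false :: v ++ zeros a)) (words k) = num_cyc a.+1 k.
Proof.
apply: eq_count => v; rewrite -(cyc_avoids_rot m 1) rot1_cons rcons_cat.
by rewrite -cats1 (zeros_catS a [::]) cats0.
Qed.

Lemma num_cycS a k : num_cyc a k.+1 = num_avoids a k + num_cyc a.+1 k.
Proof. by rewrite /num_cyc count_wordsS count_cyc_true count_cyc_false. Qed.

Lemma num_avoids_small a k : a + k <= m -> num_avoids a k = 2 ^ k.
Proof.
elim: k a => [|k IH] a ak; first by rewrite num_avoids0 -(addn0 a) ak.
by rewrite num_avoidsS !IH ?expnS; lia.
Qed.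

(** Only the word [0^k] is left out. *)
Lemma num_cyc_small a k : a + k <= m.+1 -> (num_cyc a k).+1 = 2 ^ k.
Proof.
elim: k a => [|k IH] a ak; first by rewrite num_cyc0.
by rewrite num_cycS -addnS IH ?num_avoids_small ?expnS; lia.
Qed.

(** The sum of the last [m+1] terms of [f] before index [k]; all of them when
    there are fewer.  Indexing by [j] itself, with the condition [k - j <= m+1],
    makes the sum behave well under a shift of [f] ([windowS]). *)
Definition window (f : nat -> nat) k := \sum_(j < k | k - j <= m.+1) f j.

Lemma windowS f k : window f k.+1 = (k <= m) * f 0 + window (fun j => f j.+1) k.
Proof.
rewrite /window big_mkcond big_ord_recl /= subn0 ltnS.
congr (_ + _); first by case: leqP; rewrite ?mul1n.
by rewrite [RHS]big_mkcond; apply: eq_bigr => i _; rewrite /bump add1n subSS.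
Qed.

Lemma windowD f g k : window (fun j => f j + g j) k = window f k + window g k.
Proof. exact: big_split. Qed.

Lemma eq_window f g k : f =1 g -> window f k = window g k.
Proof. by move=> fg; apply: eq_bigr => i _; rewrite fg. Qed.

(** The term of index [j] of the window counts the words whose last [1] is their
    letter [j], and the correction term counts the word [0^k].  The recurrence
    [num_avoidsS] reads words from the other end, so that the induction on [k]
    has to treat all [a] at once. *)
Lemma num_avoids_window a k :
  num_avoids a k = window (num_avoids a) k + (a + k <= m).
Proof.
elim: k a => [|k IH] a; first by rewrite /window big_ord0 num_avoids0 addn0.
rewrite windowS num_avoids0 (eq_window _ (num_avoidsS a)) windowD num_avoidsS.
rewrite (IH a.+1).
have -> : window (fun j => (a <= m) * num_avoids 0 j) k =
          (a <= m) * window (num_avoids 0) k.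
  by rewrite /window big_distrr.
rewrite {1}(IH 0) add0n; case: (leqP a m); case: (leqP k m); lia.
Qed.

(** By induction on [k] for all [a] at once; the correction terms of
    [num_avoids_window] add up along the recurrence [num_cycS]. *)
Lemma num_cyc_window a k :
  num_cyc a k = window (num_cyc a) k + k * (a + k <= m.+1).
Proof.
elim: k a => [|k IH] a; first by rewrite /window big_ord0 num_cyc0.
rewrite windowS num_cyc0 (eq_window _ (num_cycS a)) windowD num_cycS (IH a.+1).
rewrite {1}num_avoids_window; lia.
Qed.

Lemma window_ge f n : m < n -> window f n = \sum_(1 <= i < m.+2) f (n - i).
Proof.
move=> mn; rewrite /window -(big_mkord (fun j => n - j <= m.+1) f).
rewrite (big_cat_nat (n := n - m.+1)) ?leq_subr //= big_nat_cond.
rewrite big_pred0 ?add0n; last by move=> i; lia.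
rewrite big_nat_cond (eq_bigl (fun i => n - m.+1 <= i < n)); last by move=> i; lia.
rewrite -big_nat big_nat_rev /= -{1}(add0n (n - m.+1)) big_addn subKn //.
rewrite big_add1 /= !big_mkord; apply: eq_bigr => i _; congr f.
have := ltn_ord i; lia.
Qed.

End Counts.

Local Open Scope ring_scope.

(** * The sequences H and G *)

(** [num_cyc m 0] vanishes at [0], where the sequence H has the value [m.+1]; this
    makes up for the correction term of [num_cyc_window] at index [m.+1]. *)
Lemma H_num_cyc m n : H m.+1 n = (num_cyc m 0 n + m.+1 * (n == 0%N))%N.
Proof.
elim/ltn_ind: n => n IH; have [nm|mn] := leqP n m.
  case: n nm {IH} => [|n] nm; first by rewrite H_init0 // num_cyc0 muln1.
  by rewrite H_init //= muln0 addn0 -natrX -(num_cyc_small (m := m) (a := 0)); lia.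
rewrite H_rec // big_nat.
under eq_bigr => i /andP[i0 im] do [rewrite IH; last by lia].
rewrite -big_nat -(big_morph _ PoszD (erefl _)) big_split /=.
rewrite -window_ge // -big_distrr /=.
congr Posz; rewrite [in RHS]num_cyc_window -addnA; congr addn.
(* The index [n - i] is 0 only for the last term, when [n = m.+1]. *)
rewrite big_nat_recr //= big_nat big1 ?add0n; last by move=> i im; apply/eqP; lia.
rewrite (_ : (n == 0) = false)%N ?muln0 ?addn0; last by lia.
have [nm|nm] := leqP n m.+1; last by rewrite muln0 subn_eq0 leqNgt nm muln0.
by rewrite (_ : n = m.+1) ?subnn ?muln1 //; lia.
Qed.

(** The two correction terms, [k <= m] and [k * (k <= m)], vanish for [k > m]; for
    [k <= m] the two counts are [2 ^ k] and [2 ^ k - 1]. *)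
Lemma G_num_cyc m k : G m.+1 k = (num_avoids m 0 k)%:Z - (num_cyc m 1 k)%:Z.
Proof.
elim/ltn_ind: k => k IH; have [km|mk] := leqP k m.
  rewrite G_init // num_avoids_small //.
  by rewrite -(num_cyc_small (m := m) (a := 1)) //; lia.
rewrite G_rec // big_nat.
under eq_bigr => i /andP[i0 im] do [rewrite IH; last by lia].
rewrite -big_nat sumrB -!(big_morph _ PoszD (erefl _)) -!window_ge //.
rewrite {1}num_avoids_window {1}num_cyc_window; lia.
Qed.

Lemma perm_sk s t : perm_eq s t -> sk s = sk t.
Proof. by move=> /seq.permP st; rewrite /sk !st. Qed.

Theorem theorem1 (n m : nat) (hn : (0 < n)%N) :
  (sk (K n m) = - G m.+1 n.-1)%R /\ ((size (K n m))%:Z = H m.+1 n)%R.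
Proof.
have KE := perm_K_heads m hn; split; last first.
  rewrite (perm_size KE) size_map size_filter H_num_cyc eqn0Ngt hn muln0 addn0.
  by congr Posz; apply: eq_count => w; rewrite cats0.
rewrite (perm_sk KE); case: n hn {KE} => // n _.
rewrite /sk !count_map !count_filter !count_wordsS /= G_num_cyc opprB.
congr (Posz _ - Posz _).
  (* The words starting with [1] contribute no letter [0]. *)
  rewrite -[RHS]count_cyc_false (eq_count (a2 := pred0)) ?count_pred0 //.
  by apply: eq_count => w; rewrite /= cats0.
rewrite -[RHS]count_cyc_true addnC (eq_count (a2 := pred0)) ?count_pred0 //.
by apply: eq_count => w; rewrite /= cats0.
Qed.
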